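(* For every positive integer $k$, $$W(2k+1,2)=\frac{1}{2^{2k-1}}\sum_{j=1}^k(2^{2j+1}-1)\,\zeta(2j+1)\,\bar\zeta(2k-2j).$$
   Context: For positive integers $k_1,k_2$, $\bar T(k_1,k_2):=4\sum_{0<n_1<n_2}\frac{(-1)^{n_2}}{(2n_1-1)^{k_1}(2n_2-2)^{k_2}}$, and $W(K,2):=\sum_{k_1+k_2=K,\,k_1,k_2\ge1}\bar T(k_1,k_2)$. $\zeta$ is the Riemann zeta function; $\bar\zeta(s):=\sum_{n\ge1}(-1)^{n-1}n^{-s}$ for $s\ge1$ and $\bar\zeta(0):=1/2$. *)

(* Defs.v *)
From Stdlib Require Import Reals.
From Coquelicot Require Import Coquelicot.
Open Scope R_scope.

Definition zeta (s : nat) : R :=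
  Lim_seq (fun N => sum_n_m (fun n => / (INR n) ^ s) 1 N).

Definition zetabar (s : nat) : R :=
  match s with
  | O => 1 / 2
  | _ => Lim_seq (fun N => sum_n_m (fun n => (-1) ^ (n - 1) / (INR n) ^ s) 1 N)
  end.

(* Tbar(k1,k2) = 4 sum_{0<n1<n2} (-1)^{n2} / ((2n1-1)^{k1} (2n2-2)^{k2}),
   taken as the limit N -> oo of the sum over 0 < n1 < n2 <= N
   (the n2 = 1 slice is empty). *)
Definition Tbar (k1 k2 : nat) : R :=
  4 * Lim_seq (fun N =>
    sum_n_m (fun n2 =>
      sum_n_m (fun n1 =>
        (-1) ^ n2 / ((INR (2 * n1 - 1)) ^ k1 * (INR (2 * n2 - 2)) ^ k2))
        1 (n2 - 1))
      2 N).

Definition W2 (K : nat) : R :=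
  sum_n_m (fun k1 => Tbar k1 (K - k1)) 1 (K - 1).

(* Main.v *)
(** Write [a] for the odd numbers [2i+1], [b] for the even numbers [2j+2], and
    let [O] and [L] be the partial sums of [1/a] and [(-1)^i/a].  Summing the
    geometric progression [a^-k1 b^-k2] over [k1 + k2 = 2k+1] gives
    [(a^-2k - b^-2k) / (b - a)], so that the [N]-th partial sum of [W/4] is
    exactly
      [sum_i (-1)^i a_i^-2k L(N-i) - sum_j (-1)^j b_j^-2k O(j+1)].
    On the other side, [sum_p a^-(2p+1) b^-(2k-2p)] is again geometric, with
    denominator [a (b^2 - a^2)]; splitting this denominator into partial
    fractions makes the sums over the square [i, j < N] telescope to
      [1/2 sum_i (-1)^i a_i^-2k (L(N-i) + L(N+i+1))
       - sum_j (-1)^j b_j^-2k (O(j+1) + defect)].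
    The two expressions differ by at most a constant times
    [sum_i 1/((i+1)(N-i)) = 2 H_N / (N+1)], which tends to [0]. *)

Require Import Defs.
From Stdlib Require Import Reals Lra Lia.
From Coquelicot Require Import Coquelicot.
Open Scope R_scope.

(** * Finite sums over initial segments of the naturals *)

Fixpoint psum (f : nat -> R) (N : nat) : R :=
  match N with
  | O => 0
  | S p => psum f p + f p
  end.

Lemma psum_S f N : psum f (S N) = psum f N + f N.
Proof. reflexivity. Qed.

Lemma psum_ext f g N :
  (forall i, (i < N)%nat -> f i = g i) -> psum f N = psum g N.
Proof.
  induction N as [|N IH]; intros H; [reflexivity|].
  rewrite !psum_S, IH, H; auto with arith.
Qed.

Lemma psum_plus f g N : psum (fun i => f i + g i) N = psum f N + psum g N.
Proof. induction N as [|N IH]; simpl; [|rewrite IH]; ring. Qed.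

Lemma psum_minus f g N : psum (fun i => f i - g i) N = psum f N - psum g N.
Proof. induction N as [|N IH]; simpl; [|rewrite IH]; ring. Qed.

Lemma psum_scal c f N : psum (fun i => c * f i) N = c * psum f N.
Proof. induction N as [|N IH]; simpl; [|rewrite IH]; ring. Qed.

Lemma psum_scal_r c f N : psum (fun i => f i * c) N = psum f N * c.
Proof. induction N as [|N IH]; simpl; [|rewrite IH]; ring. Qed.

Lemma psum_add f p q :
  psum f (p + q) = psum f p + psum (fun i => f (p + i)%nat) q.
Proof.
  induction q as [|q IH].
  - rewrite Nat.add_0_r; simpl; ring.
  - rewrite Nat.add_succ_r, !psum_S, IH; ring.
Qed.

Lemma psum_head f N : psum f (S N) = f O + psum (fun i => f (S i)) N.
Proof.
  change (S N) with (1 + N)%nat; rewrite psum_add; simpl; ring.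
Qed.

Lemma psum_rev f N : psum f N = psum (fun i => f (N - 1 - i)%nat) N.
Proof.
  induction N as [|N IH]; [reflexivity|].
  rewrite psum_head with (f := fun i => f (S N - 1 - i)%nat), psum_S, IH.
  replace (S N - 1 - 0)%nat with N by lia.
  rewrite Rplus_comm; f_equal.
  apply psum_ext; intros i Hi; f_equal; lia.
Qed.

Lemma psum_swap f N M :
  psum (fun i => psum (fun j => f i j) M) N =
  psum (fun j => psum (fun i => f i j) N) M.
Proof.
  induction N as [|N IH]; simpl.
  - induction M as [|M IHM]; simpl; [reflexivity|rewrite <- IHM; ring].
  - rewrite IH, <- psum_plus; reflexivity.
Qed.

Lemma psum_mult f g N M :
  psum f N * psum g M = psum (fun i => psum (fun j => f i * g j) M) N.
Proof.
  rewrite <- psum_scal_r; apply psum_ext; intros i _.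
  symmetry; apply psum_scal.
Qed.

(** Both sides sum [f i * g m] over the triangle [i + m < N]: by antidiagonals [j = i + m] on the
    left, by rows on the right. *)
Lemma psum_cauchy f g N :
  psum (fun j => psum (fun i => f i * g (j - i)%nat) (S j)) N =
  psum (fun i => f i * psum g (N - i)) N.
Proof.
  induction N as [|N IH]; [reflexivity|].
  rewrite psum_S, IH, (psum_S _ N), (psum_S _ N).
  replace (S N - N)%nat with 1%nat by lia.
  replace (N - N)%nat with 0%nat by lia.
  rewrite <- Rplus_assoc, <- psum_plus; f_equal.
  - apply psum_ext; intros i Hi.
    replace (S N - i)%nat with (S (N - i)) by lia; rewrite psum_S; ring.
  - simpl; ring.
Qed.

Lemma psum_le f g N :
  (forall i, (i < N)%nat -> f i <= g i) -> psum f N <= psum g N.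
Proof.
  induction N as [|N IH]; intros H; [apply Rle_refl|].
  rewrite !psum_S; apply Rplus_le_compat; auto with arith.
Qed.

Lemma psum_abs f N : Rabs (psum f N) <= psum (fun i => Rabs (f i)) N.
Proof.
  induction N as [|N IH]; simpl.
  - rewrite Rabs_R0; lra.
  - eapply Rle_trans; [apply Rabs_triang|lra].
Qed.

Lemma psum_const c N : psum (fun _ => c) N = INR N * c.
Proof. induction N as [|N IH]; [simpl; ring|]. rewrite psum_S, IH, S_INR; ring. Qed.

Lemma sum_n_m_psum (f : nat -> R) a N :
  sum_n_m f (S a) (a + N) = psum (fun i => f (S (a + i))) N.
Proof.
  induction N as [|N IH].
  - rewrite Nat.add_0_r, sum_n_m_zero by lia; reflexivity.
  - rewrite Nat.add_succ_r, sum_n_Sm, IH by lia; reflexivity.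
Qed.

Lemma sum_f_R0_psum f N : sum_f_R0 f N = psum f (S N).
Proof. induction N as [|N IH]; [simpl; ring|]. rewrite psum_S, <- IH; reflexivity. Qed.

Lemma is_lim_seq_psum (u : nat -> nat -> R) (l : nat -> R) n :
  (forall i, (i < n)%nat -> is_lim_seq (u i) (l i)) ->
  is_lim_seq (fun N => psum (fun i => u i N) n) (psum l n).
Proof.
  induction n as [|n IH]; intros H; simpl.
  - apply is_lim_seq_const.
  - apply is_lim_seq_plus'; auto with arith.
Qed.

(** * Odd and even denominators, and their partial fraction sums *)

(** Zero-based indices: with [n1 = i + 1] and [n2 = j + 2], the denominators [2 n1 - 1] and
    [2 n2 - 2] are [odd_ i] and [even_ j], and [n1 < n2] becomes [i <= j]. *)
Definition odd_ (i : nat) : R := 2 * INR i + 1.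
Definition even_ (j : nat) : R := 2 * INR j + 2.
Definition oddH (N : nat) : R := psum (fun i => / odd_ i) N.
Definition leib (N : nat) : R := psum (fun i => (-1) ^ i / odd_ i) N.

Lemma odd_ge1 i : 1 <= odd_ i.
Proof. unfold odd_; pose proof (pos_INR i); lra. Qed.

Lemma odd_ne0 i : odd_ i <> 0.
Proof. pose proof (odd_ge1 i); lra. Qed.

Lemma even_ge2 j : 2 <= even_ j.
Proof. unfold even_; pose proof (pos_INR j); lra. Qed.

Lemma even_ne0 j : even_ j <> 0.
Proof. pose proof (even_ge2 j); lra. Qed.

(** Parity: the difference is the image of an odd integer. *)
Lemma even_minus_odd_ne0 i j : even_ j - odd_ i <> 0.
Proof.
  unfold even_, odd_.
  replace (2 * INR j + 2 - (2 * INR i + 1))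
    with (IZR (2 * Z.of_nat j + 1 - 2 * Z.of_nat i)).
  - apply not_0_IZR; lia.
  - rewrite minus_IZR, plus_IZR, !mult_IZR, <- !INR_IZR_INZ; ring.
Qed.

Lemma even_plus_odd_ne0 i j : even_ j + odd_ i <> 0.
Proof. pose proof (odd_ge1 i); pose proof (even_ge2 j); lra. Qed.

Lemma even2_minus_odd2_ne0 i j : even_ j ^ 2 - odd_ i ^ 2 <> 0.
Proof.
  replace (even_ j ^ 2 - odd_ i ^ 2)
    with ((even_ j - odd_ i) * (even_ j + odd_ i)) by ring.
  apply Rmult_integral_contrapositive; split.
  - apply even_minus_odd_ne0.
  - apply even_plus_odd_ne0.
Qed.

Lemma pow_m1_sq p : (-1) ^ p * (-1) ^ p = 1.
Proof. rewrite <- Rpow_mult_distr; replace (-1 * -1) with 1 by ring; apply pow1. Qed.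

Lemma pow_m1_sub p q : (q <= p)%nat -> (-1) ^ (p - q) = (-1) ^ p * (-1) ^ q.
Proof.
  intros H.
  replace ((-1) ^ p) with ((-1) ^ (p - q) * (-1) ^ q)
    by (rewrite <- pow_add; f_equal; lia).
  rewrite Rmult_assoc, pow_m1_sq; ring.
Qed.

(** For [i <= j] the difference [even_ j - odd_ i] is [odd_ (j - i)], so the sum is [oddH] read
    backwards. *)
Lemma sum_inv_even_minus_odd j :
  psum (fun i => / (even_ j - odd_ i)) (S j) = oddH (S j).
Proof.
  rewrite psum_rev; unfold oddH; apply psum_ext; intros i Hi; f_equal.
  unfold even_, odd_; replace (S j - 1 - i)%nat with (j - i)%nat by lia.
  rewrite minus_INR by lia; ring.
Qed.

(** Uses [1/(a(b^2 - a^2)) = b^-2 (1/a + (1/(b-a) - 1/(b+a))/2)]. As [i] varies, [b - a] runs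
    through [odd_ j] down to [odd_ 0], then through the negatives of [odd_ 0, odd_ 1, ...]; [b + a]
    runs through consecutive odd numbers from [odd_ (S j)] on. *)
Lemma sum_inv_odd_even_diff N j :
  (j < N)%nat ->
  psum (fun i => / (odd_ i * (even_ j ^ 2 - odd_ i ^ 2))) N =
  / even_ j ^ 2 *
  (oddH (S j) + (oddH N - (oddH (N - S j) + oddH (N + S j)) / 2)).
Proof.
  intros H.
  assert (Hm : psum (fun i => / (even_ j - odd_ i)) N
               = oddH (S j) - oddH (N - S j)).
  { replace N with (S j + (N - S j))%nat at 1 by lia.
    rewrite psum_add, sum_inv_even_minus_odd; unfold Rminus; f_equal.
    rewrite <- (Rmult_1_l (oddH (N - S j))), Ropp_mult_distr_l.
    unfold oddH; rewrite <- psum_scal; apply psum_ext; intros i _.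
    pose proof (odd_ge1 i).
    replace (even_ j + - odd_ (S j + i)) with (- odd_ i).
    - field; lra.
    - unfold even_, odd_; rewrite plus_INR, S_INR; ring. }
  assert (Hp : psum (fun i => / (even_ j + odd_ i)) N
               = oddH (N + S j) - oddH (S j)).
  { unfold oddH; rewrite (Nat.add_comm N), psum_add.
    ring_simplify; apply psum_ext; intros i _; f_equal.
    unfold even_, odd_; rewrite plus_INR, S_INR; ring. }
  transitivity (/ even_ j ^ 2 *
    psum (fun i => / odd_ i + / 2 * (/ (even_ j - odd_ i) - / (even_ j + odd_ i))) N).
  - rewrite <- psum_scal; apply psum_ext; intros i _.
    pose proof (odd_ne0 i); pose proof (even_ne0 j).
    pose proof (even_minus_odd_ne0 i j); pose proof (even_plus_odd_ne0 i j).
    pose proof (even2_minus_odd2_ne0 i j).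
    field; auto.
  - rewrite psum_plus, psum_scal, psum_minus, Hm, Hp; fold (oddH N).
    field; apply even_ne0.
Qed.

(** Here [1/(b^2 - a^2) = (1/(b-a) - 1/(b+a))/(2a)]. The segments [leib i] and [leib (S i)] cancel
    up to one term, which leaves the diagonal correction [- / odd_ i]. *)
Lemma alt_sum_inv_even_odd_diff N i :
  (i < N)%nat ->
  psum (fun j => (-1) ^ j / (even_ j ^ 2 - odd_ i ^ 2)) N =
  / (2 * odd_ i) *
  ((-1) ^ i * (leib (N - i) + leib (N + S i)) - / odd_ i).
Proof.
  intros H.
  assert (Hm : psum (fun j => (-1) ^ j / (even_ j - odd_ i)) N
               = (-1) ^ i * (leib i + leib (N - i))).
  { replace N with (i + (N - i))%nat at 1 by lia.
    rewrite psum_add, psum_rev, Rmult_plus_distr_l; unfold leib.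
    rewrite <- !psum_scal; f_equal; apply psum_ext; intros j Hj.
    - pose proof (odd_ge1 j).
      replace (even_ (i - 1 - j) - odd_ i) with (- odd_ j).
      + replace (i - 1 - j)%nat with (i - S j)%nat by lia.
        (* For [j < i] the denominator is negative; its sign is absorbed by the odd shift in
           [(-1) ^ (i - S j)]. *)
        rewrite pow_m1_sub by lia; simpl; field; lra.
      + unfold even_, odd_; rewrite !minus_INR by lia; simpl; ring.
    - replace (even_ (i + j) - odd_ i) with (odd_ j).
      + rewrite pow_add; unfold Rdiv; ring.
      + unfold even_, odd_; rewrite plus_INR; ring. }
  assert (Hp : psum (fun j => (-1) ^ j / (even_ j + odd_ i)) N
               = - (-1) ^ i * (leib (N + S i) - leib (S i))).
  { unfold leib; rewrite (Nat.add_comm N), psum_add.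
    unfold Rminus; rewrite Rplus_comm, <- Rplus_assoc, Rplus_opp_l, Rplus_0_l.
    rewrite <- psum_scal; apply psum_ext; intros j _.
    replace (odd_ (S i + j)) with (even_ j + odd_ i).
    - rewrite pow_add; simpl; unfold Rdiv.
      transitivity (((-1) ^ i * (-1) ^ i) * ((-1) ^ j * / (even_ j + odd_ i))).
      + rewrite pow_m1_sq; ring.
      + ring.
    - unfold even_, odd_; rewrite plus_INR, S_INR; ring. }
  transitivity (/ (2 * odd_ i) *
    psum (fun j => (-1) ^ j / (even_ j - odd_ i) - (-1) ^ j / (even_ j + odd_ i)) N).
  - rewrite <- psum_scal; apply psum_ext; intros j _.
    pose proof (odd_ne0 i).
    pose proof (even_minus_odd_ne0 i j); pose proof (even_plus_odd_ne0 i j).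
    pose proof (even2_minus_odd2_ne0 i j).
    field; auto.
  - rewrite psum_minus, Hm, Hp; f_equal.
    replace (leib (S i)) with (leib i + (-1) ^ i / odd_ i) by reflexivity.
    transitivity ((-1) ^ i * (leib (N - i) + leib (N + S i))
                  - ((-1) ^ i * (-1) ^ i) / odd_ i).
    + unfold Rdiv; ring.
    + rewrite pow_m1_sq; unfold Rdiv; ring.
Qed.

(** * Geometric sums of mixed inverse powers *)

Lemma geom_partial_fraction a b n :
  a <> 0 -> b <> 0 -> b - a <> 0 ->
  psum (fun p => / (a ^ S p * b ^ (n - p))) n = (/ a ^ n - / b ^ n) / (b - a).
Proof.
  intros Ha Hb Hd; induction n as [|n IH].
  - simpl; field; auto.
  - rewrite psum_S.
    replace (psum (fun p => / (a ^ S p * b ^ (S n - p))) n)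
      with (/ b * psum (fun p => / (a ^ S p * b ^ (n - p))) n).
    + rewrite IH; replace (S n - n)%nat with 1%nat by lia; simpl.
      pose proof (pow_nonzero a n Ha); pose proof (pow_nonzero b n Hb).
      field; auto.
    + rewrite <- psum_scal; apply psum_ext; intros p Hp.
      replace (S n - p)%nat with (S (n - p)) by lia; simpl.
      pose proof (pow_nonzero a p Ha); pose proof (pow_nonzero b (n - p) Hb).
      field; auto.
Qed.

(** The previous identity at [a^2], [b^2], with one extra factor [/ a]. The range [p < q] leaves out
    exponent 0 of [b], which is treated apart. *)
Lemma geom_partial_fraction_sq a b q :
  a <> 0 -> b <> 0 -> b ^ 2 - a ^ 2 <> 0 ->
  psum (fun p => / (a ^ (2 * p + 3) * b ^ (2 * (q - p)))) q =
  (/ a ^ (2 * q) - / b ^ (2 * q)) * / (a * (b ^ 2 - a ^ 2)).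
Proof.
  intros Ha Hb Hd.
  pose proof (pow_nonzero a 2 Ha) as Ha2; pose proof (pow_nonzero b 2 Hb) as Hb2.
  transitivity (/ a * psum (fun p => / ((a ^ 2) ^ S p * (b ^ 2) ^ (q - p))) q).
  - rewrite <- psum_scal; apply psum_ext; intros p _.
    rewrite <- !pow_mult.
    replace (2 * p + 3)%nat with (S (2 * S p)) by lia.
    pose proof (pow_nonzero a (2 * S p) Ha).
    pose proof (pow_nonzero b (2 * (q - p)) Hb).
    rewrite <- tech_pow_Rmult; field; auto.
  - rewrite geom_partial_fraction, <- !pow_mult by auto.
    pose proof (pow_nonzero a (2 * q) Ha).
    pose proof (pow_nonzero b (2 * q) Hb).
    field; auto.
Qed.

(** * Truncated sums and their exact evaluation *)

Definition oddS (s N : nat) : R := psum (fun i => / odd_ i ^ s) N.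
Definition altEvenS (s N : nat) : R := psum (fun j => (-1) ^ j / even_ j ^ s) N.
(** Partial sum of [Tbar k1 k2 / 4]; the sign [(-1)^n2] equals [(-1)^j] because [n2 = j + 2]. *)
Definition tbarS (k1 k2 N : nat) : R :=
  psum (fun j => (-1) ^ j * (oddS k1 (S j) / even_ j ^ k2)) N.

(** After the geometric sum over [p], [b - a] is [odd_ (j - i)]. Splitting [(-1)^j] as
    [(-1)^i (-1)^(j-i)] makes the [a] part a Cauchy product with the Leibniz terms; the [b] part
    sums over [i] to [oddH]. *)
Lemma tbarS_sum n N :
  psum (fun p => tbarS (S p) (n - p) N) n =
  psum (fun i => (-1) ^ i / odd_ i ^ n * leib (N - i)) N
  - psum (fun j => (-1) ^ j / even_ j ^ n * oddH (S j)) N.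
Proof.
  unfold leib; rewrite <- psum_cauchy, <- psum_minus; unfold tbarS.
  rewrite psum_swap; apply psum_ext; intros j _.
  rewrite <- sum_inv_even_minus_odd, <- psum_scal, <- psum_minus.
  unfold oddS.
  transitivity (psum (fun p => psum (fun i =>
    (-1) ^ j * / (odd_ i ^ S p * even_ j ^ (n - p))) (S j)) n).
  - apply psum_ext; intros p _; unfold Rdiv.
    rewrite <- psum_scal_r, <- psum_scal; apply psum_ext; intros i _.
    rewrite Rinv_mult; reflexivity.
  - rewrite psum_swap; apply psum_ext; intros i Hi.
    rewrite psum_scal, geom_partial_fraction;
      auto using odd_ne0, even_ne0, even_minus_odd_ne0.
    replace (odd_ (j - i)) with (even_ j - odd_ i)
      by (unfold even_, odd_; rewrite minus_INR by lia; ring).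
    replace ((-1) ^ j) with ((-1) ^ i * (-1) ^ (j - i))
      by (rewrite <- pow_add; f_equal; lia).
    unfold Rdiv; ring.
Qed.

(** Truncation error: how far [oddH N] is from the mean of the values at [N - S j] and [N + S j]. *)
Definition oddH_defect (N j : nat) : R :=
  oddH N - (oddH (N - S j) + oddH (N + S j)) / 2.

(** The geometric sum over [p] ([H1]) leaves two double sums: one is summed over [j] first ([H2]),
    the other over [i] first ([H3]). The term [/ 2 * oddS (2 * q + 3) N], the future [zetabar 0]
    contribution, cancels the diagonal correction in [H2]. *)
Lemma oddS_altEvenS_sum q N :
  psum (fun p => oddS (2 * p + 3) N * altEvenS (2 * (q - p)) N) q
  + / 2 * oddS (2 * q + 3) N =
  / 2 * psum (fun i => (-1) ^ i / odd_ i ^ (2 * q + 2)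
                       * (leib (N - i) + leib (N + S i))) N
  - psum (fun j => (-1) ^ j / even_ j ^ (2 * q + 2)
                   * (oddH (S j) + oddH_defect N j)) N.
Proof.
  assert (H1 : psum (fun p => oddS (2 * p + 3) N * altEvenS (2 * (q - p)) N) q =
    psum (fun i => psum (fun j =>
      / odd_ i ^ (2 * q + 1) * ((-1) ^ j / (even_ j ^ 2 - odd_ i ^ 2))
      - (-1) ^ j / even_ j ^ (2 * q) * / (odd_ i * (even_ j ^ 2 - odd_ i ^ 2))) N) N).
  { unfold oddS, altEvenS.
    transitivity (psum (fun p => psum (fun i => psum (fun j =>
      (-1) ^ j * / (odd_ i ^ (2 * p + 3) * even_ j ^ (2 * (q - p)))) N) N) q).
    - apply psum_ext; intros p _; rewrite psum_mult.
      apply psum_ext; intros i _; apply psum_ext; intros j _.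
      rewrite Rinv_mult; unfold Rdiv; ring.
    - rewrite psum_swap; apply psum_ext; intros i _.
      rewrite psum_swap; apply psum_ext; intros j _.
      pose proof (odd_ne0 i); pose proof (even_ne0 j).
      pose proof (even2_minus_odd2_ne0 i j).
      rewrite psum_scal, geom_partial_fraction_sq by auto.
      replace (2 * q + 1)%nat with (S (2 * q)) by lia.
      rewrite <- (tech_pow_Rmult (odd_ i) (2 * q)).
      pose proof (pow_nonzero (odd_ i) (2 * q)); pose proof (pow_nonzero (even_ j) (2 * q)).
      field; auto. }
  assert (H2 : psum (fun i => psum (fun j =>
      / odd_ i ^ (2 * q + 1) * ((-1) ^ j / (even_ j ^ 2 - odd_ i ^ 2))) N) N =
    / 2 * psum (fun i => (-1) ^ i / odd_ i ^ (2 * q + 2)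
                       * (leib (N - i) + leib (N + S i))) N
    - / 2 * oddS (2 * q + 3) N).
  { unfold oddS; rewrite <- !psum_scal, <- psum_minus.
    apply psum_ext; intros i Hi.
    rewrite psum_scal, alt_sum_inv_even_odd_diff by exact Hi.
    replace (2 * q + 3)%nat with (S (S (2 * q + 1))) by lia.
    replace (2 * q + 2)%nat with (S (2 * q + 1)) by lia.
    rewrite <- !tech_pow_Rmult.
    pose proof (odd_ne0 i); pose proof (pow_nonzero (odd_ i) (2 * q + 1)).
    field; auto. }
  assert (H3 : psum (fun i => psum (fun j =>
      (-1) ^ j / even_ j ^ (2 * q) * / (odd_ i * (even_ j ^ 2 - odd_ i ^ 2))) N) N =
    psum (fun j => (-1) ^ j / even_ j ^ (2 * q + 2)
                   * (oddH (S j) + oddH_defect N j)) N).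
  { rewrite psum_swap; apply psum_ext; intros j Hj.
    rewrite psum_scal, sum_inv_odd_even_diff by exact Hj.
    fold (oddH_defect N j); rewrite pow_add.
    pose proof (even_ne0 j); pose proof (pow_nonzero (even_ j) (2 * q)).
    field; auto. }
  rewrite H1, <- H3.
  transitivity (psum (fun i => psum (fun j =>
      / odd_ i ^ (2 * q + 1) * ((-1) ^ j / (even_ j ^ 2 - odd_ i ^ 2))) N) N
    - psum (fun i => psum (fun j =>
      (-1) ^ j / even_ j ^ (2 * q) * / (odd_ i * (even_ j ^ 2 - odd_ i ^ 2))) N) N
    + / 2 * oddS (2 * q + 3) N).
  - f_equal; rewrite <- psum_minus; apply psum_ext; intros i _; apply psum_minus.
  - rewrite H2; ring.
Qed.

(** * Bounds for the truncation errors *)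

(** Alternating series estimate: the tail from [p] is its first term minus the tail from [S p],
    which lies between 0 and [/ odd_ (S p)]. *)
Lemma leib_tail p d :
  0 <= psum (fun i => (-1) ^ i / odd_ (p + i)) d <= / odd_ p.
Proof.
  revert p; induction d as [|d IH]; intros p.
  - simpl; split; [lra|].
    left; apply Rinv_0_lt_compat; pose proof (odd_ge1 p); lra.
  - rewrite psum_head, Nat.add_0_r.
    replace (psum (fun i => (-1) ^ S i / odd_ (p + S i)) d)
      with (- psum (fun i => (-1) ^ i / odd_ (S p + i)) d).
    + destruct (IH (S p)) as [H0 H1].
      assert (/ odd_ (S p) <= / odd_ p).
      { apply Rinv_le_contravar; [pose proof (odd_ge1 p); lra|].
        unfold odd_; rewrite S_INR; lra. }
      simpl pow; unfold Rdiv at 1 3; rewrite Rmult_1_l; lra.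
    + rewrite <- (Rmult_1_l (psum _ d)), Ropp_mult_distr_l, <- psum_scal.
      apply psum_ext; intros i _; rewrite Nat.add_succ_r; simpl.
      unfold Rdiv; ring.
Qed.

Lemma leib_diff_le p q : (p <= q)%nat -> Rabs (leib p - leib q) <= / odd_ p.
Proof.
  intros H; unfold leib; replace q with (p + (q - p))%nat by lia.
  rewrite psum_add.
  replace (psum (fun i => (-1) ^ (p + i) / odd_ (p + i)) (q - p))
    with ((-1) ^ p * psum (fun i => (-1) ^ i / odd_ (p + i)) (q - p)).
  - destruct (leib_tail p (q - p)) as [H0 H1].
    match goal with |- Rabs (?a - (?a + ?s * ?t)) <= _ =>
      replace (a - (a + s * t)) with (- (s * t)) by ring end.
    rewrite Rabs_Ropp, Rabs_mult, pow_1_abs, Rmult_1_l, Rabs_pos_eq; assumption.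
  - rewrite <- psum_scal; apply psum_ext; intros i _.
    rewrite pow_add; unfold Rdiv; ring.
Qed.

Lemma oddH_diff p d : 0 <= oddH (p + d) - oddH p <= INR d / odd_ p.
Proof.
  unfold oddH; rewrite psum_add.
  match goal with |- 0 <= ?a + ?b - ?a <= _ => replace (a + b - a) with b by ring end.
  unfold Rdiv; rewrite <- (psum_const (/ odd_ p)); split.
  - replace 0 with (psum (fun _ => 0) d) by (rewrite psum_const; ring).
    apply psum_le; intros i _; left; apply Rinv_0_lt_compat.
    pose proof (odd_ge1 (p + i)); lra.
  - apply psum_le; intros i _; apply Rinv_le_contravar.
    + pose proof (odd_ge1 p); lra.
    + unfold odd_; rewrite plus_INR; pose proof (pos_INR i); lra.
Qed.

(** The defect is half the difference of the increments of [oddH] over two adjacent blocks of length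
    [S j]; both increments lie between 0 and the bound. *)
Lemma oddH_defect_le N j :
  (j < N)%nat -> Rabs (oddH_defect N j) <= INR (S j) / odd_ (N - S j).
Proof.
  intros H.
  pose proof (oddH_diff (N - S j) (S j)) as H1.
  replace (N - S j + S j)%nat with N in H1 by lia.
  pose proof (oddH_diff N (S j)) as H2.
  assert (INR (S j) / odd_ N <= INR (S j) / odd_ (N - S j)).
  { apply Rmult_le_compat_l; [apply pos_INR|].
    apply Rinv_le_contravar; [pose proof (odd_ge1 (N - S j)); lra|].
    unfold odd_; rewrite minus_INR by lia; pose proof (pos_INR (S j)); lra. }
  unfold oddH_defect; apply Rabs_le; lra.
Qed.

(** * The harmonic convolution and its decay *)

Definition harm (N : nat) : R := psum (fun i => / INR (S i)) N.

Lemma INR_S_pos i : 0 < INR (S i).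
Proof. apply lt_0_INR; lia. Qed.

Lemma is_lim_seq_inv_INR_S : is_lim_seq (fun n => / INR (S n)) 0.
Proof.
  apply (is_lim_seq_incr_1 (fun n => / INR n)).
  replace (Finite 0) with (Rbar_inv p_infty) by reflexivity.
  apply is_lim_seq_inv; [apply is_lim_seq_INR|discriminate].
Qed.

(** Cesaro means of the null sequence [1/(n+1)]. *)
Lemma is_lim_seq_harm_mean : is_lim_seq (fun N => harm (S N) / INR (S N)) 0.
Proof.
  pose proof (proj1 (is_lim_seq_Reals _ _) is_lim_seq_inv_INR_S) as H0.
  apply Cesaro_1 in H0; apply is_lim_seq_Reals, is_lim_seq_incr_1 in H0.
  apply is_lim_seq_ext with (2 := H0); intros n; unfold harm.
  rewrite <- sum_f_R0_psum; reflexivity.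
Qed.

Definition harm_conv (N : nat) : R :=
  psum (fun i => / (INR (S i) * INR (N - i))) N.

(** Since [x + y = N + 1] for the two factors, [1/(xy) = (1/x + 1/y)/(N + 1)], and each half sums to
    [harm N]. *)
Lemma harm_conv_eq N : harm_conv N = 2 / INR (S N) * harm N.
Proof.
  transitivity (/ INR (S N) *
    (harm N + psum (fun i => / INR (S (N - 1 - i))) N)).
  - unfold harm; rewrite <- psum_plus, <- psum_scal; apply psum_ext; intros i Hi.
    replace (S (N - 1 - i)) with (N - i)%nat by lia.
    assert (HS : INR (S N) = INR (S i) + INR (N - i))
      by (rewrite <- plus_INR; f_equal; lia).
    assert (0 < INR (N - i)) by (apply lt_0_INR; lia).
    pose proof (INR_S_pos i).
    rewrite HS; field; repeat split; lra.
  - rewrite <- (psum_rev (fun i => / INR (S i))); fold (harm N).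
    unfold Rdiv; ring.
Qed.

Lemma is_lim_seq_harm_conv : is_lim_seq harm_conv 0.
Proof.
  apply is_lim_seq_incr_1.
  apply is_lim_seq_le_le with (u := fun _ => 0)
    (w := fun N => 2 * (harm (S N) / INR (S N))).
  - intros N; rewrite harm_conv_eq.
    assert (Hh : 0 <= harm (S N)).
    { unfold harm; replace 0 with (psum (fun _ => 0) (S N))
        by (rewrite psum_const; ring).
      apply psum_le; intros i _; left; apply Rinv_0_lt_compat, INR_S_pos. }
    pose proof (INR_S_pos N); pose proof (INR_S_pos (S N)).
    assert (0 < / INR (S (S N))) by (apply Rinv_0_lt_compat; lra).
    assert (/ INR (S (S N)) <= / INR (S N))
      by (apply Rinv_le_contravar; [lra|rewrite (S_INR (S N)); lra]).
    unfold Rdiv; split; nra.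
  - apply is_lim_seq_const.
  - replace (Finite 0) with (Finite (2 * 0)) by (f_equal; ring).
    apply is_lim_seq_mult'; [apply is_lim_seq_const|apply is_lim_seq_harm_mean].
Qed.

Lemma inv_pow_le x y n : 0 < y <= x -> 1 <= x -> / x ^ S n <= / y.
Proof.
  intros H H1; apply Rinv_le_contravar; [lra|].
  apply Rle_trans with (x ^ 1); [lra|apply Rle_pow; [lra|lia]].
Qed.

(** * Comparison of the two truncated expressions *)

(** In the difference of the two exact formulas only half of [leib (N - i) - leib (N + S i)] and the
    defect survive. Each is dominated termwise by the harmonic convolution, with total weight
    [1/2 + 1 <= 2]. *)
Lemma tbarS_sum_approx q N :
  Rabs (psum (fun p => tbarS (S p) (2 * q + 2 - p) N) (2 * q + 2)
        - (psum (fun p => oddS (2 * p + 3) N * altEvenS (2 * (q - p)) N) q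
           + / 2 * oddS (2 * q + 3) N))
  <= 2 * harm_conv N.
Proof.
  rewrite tbarS_sum, oddS_altEvenS_sum.
  set (n := (2 * q + 2)%nat).
  match goal with |- Rabs ?e <= _ => replace e with (psum (fun i =>
    / 2 * ((-1) ^ i / odd_ i ^ n * (leib (N - i) - leib (N + S i)))
    + (-1) ^ i / even_ i ^ n * oddH_defect N i) N) end.
  - eapply Rle_trans; [apply psum_abs|].
    unfold harm_conv; rewrite <- psum_scal; apply psum_le; intros i Hi.
    assert (HN : 0 < INR (N - i)) by (apply lt_0_INR; lia).
    pose proof (INR_S_pos i) as Hi0.
    assert (A : Rabs ((-1) ^ i / odd_ i ^ n * (leib (N - i) - leib (N + S i)))
                <= / (INR (S i) * INR (N - i))).
    { unfold Rdiv; rewrite !Rabs_mult, pow_1_abs, Rmult_1_l, Rinv_mult.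
      apply Rmult_le_compat; try apply Rabs_pos.
      - rewrite Rabs_pos_eq.
        + unfold n; replace (2 * q + 2)%nat with (S (2 * q + 1)) by lia.
          apply inv_pow_le; [|apply odd_ge1].
          unfold odd_; rewrite S_INR in *; pose proof (pos_INR i); lra.
        + left; apply Rinv_0_lt_compat, pow_lt; pose proof (odd_ge1 i); lra.
      - eapply Rle_trans; [apply leib_diff_le; lia|].
        apply Rinv_le_contravar; [lra|unfold odd_; lra]. }
    (* The defect bound carries a factor [S i], so two powers of [/ INR (S i)] are taken from
       [even_ i ^ n]; this uses [n >= 2]. *)
    assert (B : Rabs ((-1) ^ i / even_ i ^ n * oddH_defect N i)
                <= / (INR (S i) * INR (N - i))).
    { unfold Rdiv; rewrite !Rabs_mult, pow_1_abs, Rmult_1_l.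
      apply Rle_trans with (/ INR (S i) ^ 2 * (INR (S i) / INR (N - i))).
      - apply Rmult_le_compat; try apply Rabs_pos.
        + pose proof (even_ge2 i).
          rewrite Rabs_pos_eq by (left; apply Rinv_0_lt_compat, pow_lt; lra).
          apply Rinv_le_contravar; [apply pow_lt; lra|].
          apply Rle_trans with (even_ i ^ 2); [|apply Rle_pow; [lra|unfold n; lia]].
          apply pow_incr; unfold even_; rewrite S_INR in *; pose proof (pos_INR i); lra.
        + eapply Rle_trans; [apply oddH_defect_le; exact Hi|].
          apply Rmult_le_compat_l; [lra|].
          apply Rinv_le_contravar; [lra|].
          replace (N - i)%nat with (S (N - S i)) by lia.
          unfold odd_; rewrite (S_INR (N - S i)); pose proof (pos_INR (N - S i)); lra.
      - right; field; split; lra. }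
    eapply Rle_trans; [apply Rabs_triang|].
    rewrite Rabs_mult, (Rabs_pos_eq (/ 2)) by lra.
    pose proof (Rabs_pos ((-1) ^ i / odd_ i ^ n * (leib (N - i) - leib (N + S i)))).
    lra.
  - rewrite psum_plus, psum_scal.
    rewrite (psum_ext _ (fun i => (-1) ^ i / odd_ i ^ n * leib (N - i)
      - (-1) ^ i / odd_ i ^ n * leib (N + S i))) by (intros; ring).
    rewrite (psum_ext (fun i => (-1) ^ i / odd_ i ^ n * (leib (N - i) + leib (N + S i)))
      (fun i => (-1) ^ i / odd_ i ^ n * leib (N - i)
      + (-1) ^ i / odd_ i ^ n * leib (N + S i))) by (intros; ring).
    rewrite (psum_ext (fun j => (-1) ^ j / even_ j ^ n * (oddH (S j) + oddH_defect N j))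
      (fun j => (-1) ^ j / even_ j ^ n * oddH (S j)
      + (-1) ^ j / even_ j ^ n * oddH_defect N j)) by (intros; ring).
    rewrite !psum_plus, psum_minus; field.
Qed.

(** * Convergence of the alternating sums *)

Lemma alternating_psum_cv (u : nat -> R) :
  Un_decreasing u -> is_lim_seq u 0 ->
  ex_finite_lim_seq (psum (fun i => (-1) ^ i * u i)).
Proof.
  intros Hd H0; apply is_lim_seq_Reals in H0.
  destruct (alternated_series u Hd H0) as [l Hl].
  exists l; apply is_lim_seq_incr_1; apply is_lim_seq_Reals in Hl.
  apply is_lim_seq_ext with (2 := Hl); intros n; apply sum_f_R0_psum.
Qed.

Lemma inv_odd_pow_pos i s : 0 < / odd_ i ^ s.
Proof. apply Rinv_0_lt_compat, pow_lt; pose proof (odd_ge1 i); lra. Qed.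

Lemma oddS_nonneg s N : 0 <= oddS s N.
Proof.
  replace 0 with (psum (fun _ => 0) N) by (rewrite psum_const; ring).
  apply psum_le; intros i _; left; apply inv_odd_pow_pos.
Qed.

(* [oddS k1 (S j) / even_ j] is, up to a factor 2, the mean of the first
   [S j] terms of a nonincreasing sequence, hence nonincreasing. *)
Lemma oddS_over_even_decreasing k1 k2 :
  Un_decreasing (fun j => oddS k1 (S j) / even_ j ^ S k2).
Proof.
  intros j.
  pose proof (oddS_nonneg k1 (S j)) as HA.
  pose proof (even_ge2 j) as He.
  assert (HE : even_ (S j) = even_ j + 2) by (unfold even_; rewrite S_INR; ring).
  assert (Hc : INR (S j) * / odd_ (S j) ^ k1 <= oddS k1 (S j)).
  { rewrite <- (psum_const (/ odd_ (S j) ^ k1)).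
    apply psum_le; intros i Hi; apply Rinv_le_contravar.
    - apply pow_lt; pose proof (odd_ge1 i); lra.
    - apply pow_incr; pose proof (odd_ge1 i); split; [lra|].
      unfold odd_; apply lt_INR in Hi; lra. }
  assert (HI : INR (S j) = even_ j / 2) by (unfold even_; rewrite S_INR; field).
  rewrite HI in Hc.
  change (oddS k1 (S (S j))) with (oddS k1 (S j) + / odd_ (S j) ^ k1).
  set (A := oddS k1 (S j)) in *; set (c := / odd_ (S j) ^ k1) in *.
  (* The new term is at most the mean of the earlier ones, so [c <= 2 A / even_ j], while
     [even_ (S j) = even_ j + 2]. *)
  assert (H1 : A + c <= A * even_ (S j) / even_ j).
  { apply Rmult_le_reg_r with (even_ j); [lra|].
    unfold Rdiv; rewrite Rmult_assoc, Rinv_l, HE by lra; nra. }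
  assert (P0 : 0 < even_ j ^ k2) by (apply pow_lt; lra).
  assert (P1 : 0 < even_ (S j) ^ k2) by (apply pow_lt; lra).
  assert (P : even_ j ^ k2 <= even_ (S j) ^ k2) by (apply pow_incr; lra).
  (* One factor of the denominator carries the comparison of means; the other [k2] factors are
     nondecreasing. *)
  apply Rle_trans with (A * even_ (S j) / even_ j * / even_ (S j) ^ S k2).
  - apply Rmult_le_compat_r; [|exact H1].
    left; apply Rinv_0_lt_compat, pow_lt; lra.
  - replace (A * even_ (S j) / even_ j * / even_ (S j) ^ S k2)
      with (A / even_ j * / even_ (S j) ^ k2)
      by (simpl; field; repeat split; lra).
    replace (A / even_ j ^ S k2) with (A / even_ j * / even_ j ^ k2)
      by (simpl; field; split; lra).
    apply Rmult_le_compat_l.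
    + apply Rmult_le_pos; [exact HA|left; apply Rinv_0_lt_compat; lra].
    + apply Rinv_le_contravar; assumption.
Qed.

Lemma oddS_over_even_lim k1 k2 :
  is_lim_seq (fun j => oddS (S k1) (S j) / even_ j ^ S k2) 0.
Proof.
  apply is_lim_seq_le_le with (u := fun _ => 0)
    (w := fun j => harm (S j) / INR (S j)).
  - intros j; pose proof (even_ge2 j).
    assert (0 < / even_ j ^ S k2) by (apply Rinv_0_lt_compat, pow_lt; lra).
    split.
    + apply Rmult_le_pos; [apply oddS_nonneg|lra].
    + apply Rmult_le_compat; [apply oddS_nonneg|lra| |].
      * apply psum_le; intros i _; apply inv_pow_le; [|apply odd_ge1].
        split; [apply INR_S_pos|].
        unfold odd_; rewrite S_INR; pose proof (pos_INR i); lra.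
      * apply inv_pow_le; [|lra].
        split; [apply INR_S_pos|].
        unfold even_; rewrite S_INR; pose proof (pos_INR j); lra.
  - apply is_lim_seq_const.
  - apply is_lim_seq_harm_mean.
Qed.

(** The Leibniz criterion in [j] gives a finite limit, so the [Lim_seq] inside [Tbar] is a genuine
    limit even when [k1] or [k2] is 1. *)
Lemma is_lim_seq_tbarS k1 k2 :
  is_lim_seq (tbarS (S k1) (S k2)) (Tbar (S k1) (S k2) / 4).
Proof.
  destruct (alternating_psum_cv _ (oddS_over_even_decreasing (S k1) k2)
              (oddS_over_even_lim k1 k2)) as [l Hl].
  change (is_lim_seq (tbarS (S k1) (S k2)) l) in Hl.
  replace (Tbar (S k1) (S k2) / 4) with l; [exact Hl|].
  unfold Tbar.
  match goal with |- _ = 4 * real (Lim_seq ?u) / 4 => assert (Hu : is_lim_seq u l) end.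
  (* The outer sum starts at [n2 = 2], so the upper bound [S N] corresponds to [N] terms. *)
  { apply is_lim_seq_incr_1; apply is_lim_seq_ext with (2 := Hl); intros N.
    change (S N) with (1 + N)%nat; rewrite sum_n_m_psum.
    apply psum_ext; intros j _.
    replace (S (1 + j) - 1)%nat with (0 + S j)%nat by lia; rewrite sum_n_m_psum.
    unfold oddS, Rdiv; rewrite <- psum_scal_r, <- psum_scal.
    apply psum_ext; intros i _.
    replace (2 * S (0 + i) - 1)%nat with (2 * i + 1)%nat by lia.
    replace (2 * S (1 + j) - 2)%nat with (2 * j + 2)%nat by lia.
    replace (INR (2 * i + 1)) with (odd_ i)
      by (rewrite plus_INR, mult_INR; reflexivity).
    replace (INR (2 * j + 2)) with (even_ j)
      by (rewrite plus_INR, mult_INR; reflexivity).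
    replace ((-1) ^ S (1 + j)) with ((-1) ^ j) by (simpl; ring).
    rewrite Rinv_mult; ring. }
  rewrite (is_lim_seq_unique _ _ Hu); simpl; field.
Qed.

(** The factor [2 ^ S s] comes from [even_ j = 2 (j + 1)]. Exponent 0 is excluded: those partial
    sums oscillate, and [zetabar 0] is a convention. *)
Lemma is_lim_seq_altEvenS s :
  is_lim_seq (altEvenS (S s)) (zetabar (S s) / 2 ^ S s).
Proof.
  assert (Hd : Un_decreasing (fun j => / INR (S j) ^ S s)).
  { intros j; pose proof (INR_S_pos j); apply Rinv_le_contravar.
    - apply pow_lt; lra.
    - apply pow_incr; rewrite (S_INR (S j)); lra. }
  assert (H0 : is_lim_seq (fun j => / INR (S j) ^ S s) 0).
  { apply is_lim_seq_le_le with (u := fun _ => 0) (w := fun j => / INR (S j)).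
    - intros j; pose proof (INR_S_pos j); split.
      + left; apply Rinv_0_lt_compat, pow_lt; lra.
      + apply inv_pow_le; [lra|]. rewrite S_INR; pose proof (pos_INR j); lra.
    - apply is_lim_seq_const.
    - apply is_lim_seq_inv_INR_S. }
  destruct (alternating_psum_cv _ Hd H0) as [l Hl].
  replace (zetabar (S s)) with l.
  - apply is_lim_seq_ext with
      (fun N => psum (fun i => (-1) ^ i * / INR (S i) ^ S s) N * / 2 ^ S s).
    + intros N; unfold altEvenS; rewrite <- psum_scal_r.
      apply psum_ext; intros j _.
      replace (even_ j) with (2 * INR (S j)) by (unfold even_; rewrite S_INR; ring).
      unfold Rdiv; rewrite Rpow_mult_distr, Rinv_mult; ring.
    + apply is_lim_seq_mult'; [exact Hl|apply is_lim_seq_const].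
  - unfold zetabar.
    match goal with |- _ = real (Lim_seq ?u) => assert (Hu : is_lim_seq u l) end.
    { apply is_lim_seq_ext with (2 := Hl); intros N.
      change N with (0 + N)%nat at 2; rewrite sum_n_m_psum.
      apply psum_ext; intros j _.
      replace (S (0 + j) - 1)%nat with j by lia; reflexivity. }
    rewrite (is_lim_seq_unique _ _ Hu); reflexivity.
Qed.

(** * Zeta values and sums over odd numbers *)

Definition zetaS (s N : nat) : R := psum (fun i => / INR (S i) ^ s) N.

(** Telescoping through [1/(m+1)^2 <= 1/m - 1/(m+1)]; the bound feeds monotone convergence. *)
Lemma zetaS_bound s N : zetaS (S (S s)) (S N) <= 2 - / INR (S N).
Proof.
  induction N as [|N IH].
  - unfold zetaS; simpl psum; simpl INR; rewrite pow1, Rinv_1; lra.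
  - unfold zetaS in *; rewrite psum_S.
    pose proof (INR_S_pos N) as HN.
    assert (H1 : / INR (S (S N)) ^ S (S s) <= / INR (S (S N)) ^ 2).
    { rewrite (S_INR (S N)); apply Rinv_le_contravar; [apply pow_lt; lra|].
      apply Rle_pow; [lra|lia]. }
    assert (H2 : / INR (S (S N)) ^ 2 <= / INR (S N) - / INR (S (S N))).
    { rewrite (S_INR (S N)).
      replace (/ INR (S N) - / (INR (S N) + 1))
        with (/ (INR (S N) * (INR (S N) + 1))) by (field; lra).
      apply Rinv_le_contravar; nra. }
    lra.
Qed.

Lemma is_lim_seq_zetaS s : is_lim_seq (zetaS (S (S s))) (zeta (S (S s))).
Proof.
  assert (Hl : ex_finite_lim_seq (fun N => zetaS (S (S s)) (S N))).
  { apply ex_finite_lim_seq_incr with 2.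
    - intros N; unfold zetaS; rewrite (psum_S _ (S N)).
      assert (0 < / INR (S (S N)) ^ S (S s))
        by (apply Rinv_0_lt_compat, pow_lt, INR_S_pos); lra.
    - intros N; eapply Rle_trans; [apply zetaS_bound|].
      assert (0 < / INR (S N)) by (apply Rinv_0_lt_compat, INR_S_pos); lra. }
  destruct Hl as [l Hl]; apply is_lim_seq_incr_1 in Hl.
  replace (zeta (S (S s))) with l; [exact Hl|].
  unfold zeta.
  match goal with |- _ = real (Lim_seq ?u) => assert (Hu : is_lim_seq u l) end.
  { apply is_lim_seq_ext with (2 := Hl); intros N.
    change N with (0 + N)%nat at 2; rewrite sum_n_m_psum; reflexivity. }
  rewrite (is_lim_seq_unique _ _ Hu); reflexivity.
Qed.

(** Separates odd and even integers up to [2N]; in the limit this gives the factor [1 - 2^-s]. *)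
Lemma zetaS_split s N : zetaS s (2 * N) = oddS s N + / 2 ^ s * zetaS s N.
Proof.
  unfold zetaS, oddS; induction N as [|N IH]; [simpl; ring|].
  replace (2 * S N)%nat with (S (S (2 * N))) by lia.
  rewrite !psum_S, IH.
  replace (INR (S (2 * N))) with (odd_ N)
    by (unfold odd_; rewrite S_INR, mult_INR; simpl INR; ring).
  replace (INR (S (S (2 * N)))) with (2 * INR (S N))
    by (rewrite !S_INR, mult_INR; simpl INR; ring).
  rewrite Rpow_mult_distr, Rinv_mult; ring.
Qed.

Lemma is_lim_seq_oddS s :
  is_lim_seq (oddS (S (S s)))
    ((2 ^ S (S s) - 1) * zeta (S (S s)) / 2 ^ S (S s)).
Proof.
  set (n := S (S s)).
  assert (Hz : is_lim_seq (zetaS n) (zeta n)) by apply is_lim_seq_zetaS.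
  apply is_lim_seq_ext with (fun N => zetaS n (2 * N) - / 2 ^ n * zetaS n N).
  - intros N; rewrite zetaS_split; ring.
  - replace ((2 ^ n - 1) * zeta n / 2 ^ n) with (zeta n - / 2 ^ n * zeta n)
      by (field; apply pow_nonzero; lra).
    apply is_lim_seq_minus'.
    + apply (is_lim_seq_subseq (zetaS n) (zeta n) (fun N => (2 * N)%nat));
        [apply eventually_subseq; intros; lia|exact Hz].
    + apply is_lim_seq_mult'; [apply is_lim_seq_const|exact Hz].
Qed.

(** * Passage to the limit and matching of the powers of two *)

Theorem mainTheorem10 (k : nat) (hk : (1 <= k)%nat) :
  W2 (2 * k + 1) =
  / 2 ^ (2 * k - 1) *
  sum_n_m (fun j =>
    (2 ^ (2 * j + 1) - 1) * zeta (2 * j + 1) * zetabar (2 * k - 2 * j)) 1 k.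
Proof.
  destruct k as [|q]; [lia|].
  set (n := (2 * q + 2)%nat).
  (* Shifted indices [k = q + 1], [j = p + 1], so [2j + 1 = 2p + 3]. *)
  set (t := fun p => (2 ^ (2 * p + 3) - 1) * zeta (2 * p + 3)).
  assert (HL : is_lim_seq
    (fun N => psum (fun p => tbarS (S p) (n - p) N) n)
    (W2 (2 * S q + 1) / 4)).
  { unfold W2; replace (2 * S q + 1 - 1)%nat with (0 + n)%nat by (unfold n; lia).
    rewrite sum_n_m_psum; unfold Rdiv; rewrite <- psum_scal_r.
    apply is_lim_seq_psum; intros p Hp.
    replace (2 * S q + 1 - S (0 + p))%nat with (n - p)%nat by (unfold n; lia).
    replace (n - p)%nat with (S (n - S p)) by lia.
    apply is_lim_seq_tbarS. }
  assert (Ht : forall p, is_lim_seq (oddS (2 * p + 3)) (t p / 2 ^ (2 * p + 3))).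
  { intros p; unfold t; replace (2 * p + 3)%nat with (S (S (2 * p + 1))) by lia.
    apply is_lim_seq_oddS. }
  assert (HR : is_lim_seq
    (fun N => psum (fun p => oddS (2 * p + 3) N * altEvenS (2 * (q - p)) N) q
           + / 2 * oddS (2 * q + 3) N)
    (psum (fun p => t p / 2 ^ (2 * p + 3)
        * (zetabar (2 * (q - p)) / 2 ^ (2 * (q - p)))) q
     + / 2 * (t q / 2 ^ (2 * q + 3)))).
  { apply is_lim_seq_plus'.
    - apply is_lim_seq_psum; intros p Hp; apply is_lim_seq_mult'; [apply Ht|].
      replace (2 * (q - p))%nat with (S (2 * (q - p) - 1)) by lia.
      apply is_lim_seq_altEvenS.
    - apply is_lim_seq_mult'; [apply is_lim_seq_const|apply Ht]. }
  pose proof (is_lim_seq_minus' _ _ _ _ HL HR) as HD.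
  assert (H0 : is_lim_seq (fun N => psum (fun p => tbarS (S p) (n - p) N) n -
      (psum (fun p => oddS (2 * p + 3) N * altEvenS (2 * (q - p)) N) q
           + / 2 * oddS (2 * q + 3) N)) 0).
  { apply is_lim_seq_abs_0, is_lim_seq_le_le with (u := fun _ => 0)
      (w := fun N => 2 * harm_conv N).
    - intros N; split; [apply Rabs_pos|apply tbarS_sum_approx].
    - apply is_lim_seq_const.
    - replace (Finite 0) with (Finite (2 * 0)) by (f_equal; ring).
      apply is_lim_seq_mult'; [apply is_lim_seq_const|apply is_lim_seq_harm_conv]. }
  (* The same difference tends to [W2 / 4] minus the right-hand limit and to 0, so the two limits
     agree. *)
  apply is_lim_seq_unique in HD; apply is_lim_seq_unique in H0.
  rewrite H0 in HD; apply Rbar_finite_eq in HD.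
  transitivity (4 * (psum (fun p => t p / 2 ^ (2 * p + 3)
        * (zetabar (2 * (q - p)) / 2 ^ (2 * (q - p)))) q
     + / 2 * (t q / 2 ^ (2 * q + 3)))); [lra|].
  rewrite (sum_n_m_psum _ 0 (S q)), psum_S.
  assert (P2 : forall m, 2 ^ m <> 0) by (intros; apply pow_nonzero; lra).
  replace (2 * S q - 1)%nat with (2 * q + 1)%nat by lia.
  rewrite !Rmult_plus_distr_l, <- !psum_scal; f_equal.
  - apply psum_ext; intros p Hp.
    replace (2 * S (0 + p) + 1)%nat with (2 * p + 3)%nat by lia.
    replace (2 * S q - 2 * S (0 + p))%nat with (2 * (q - p))%nat by lia.
    fold (t p).
    (* The exponents add up to [2q + 3] for every [p]; the 4 from [Tbar] lowers this to [2q + 1]. *)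
    replace (/ 2 ^ (2 * q + 1)) with (4 * / 2 ^ (2 * p + 3) * / 2 ^ (2 * (q - p))).
    + unfold Rdiv; ring.
    + assert (E : 2 ^ (2 * p + 3) * 2 ^ (2 * (q - p)) = 2 ^ 2 * 2 ^ (2 * q + 1))
        by (rewrite <- !pow_add; f_equal; lia).
      rewrite Rmult_assoc, <- Rinv_mult, E; field; apply P2.
  (* The last summand, [j = k]: the value [zetabar 0 = 1/2] matches the weight [/ 2] of
     [oddS (2 * q + 3)]. *)
  - replace (2 * S (0 + q) + 1)%nat with (2 * q + 3)%nat by lia.
    replace (2 * S q - 2 * S (0 + q))%nat with 0%nat by lia.
    fold (t q); simpl zetabar.
    replace (2 * q + 3)%nat with (2 * q + 1 + 2)%nat by lia.
    rewrite pow_add; field; auto.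
Qed.
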